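(* Let $\Gamma$ be a distance-regular graph with vertex set $X$ and diameter $D\ge 3$, let $\{E_i\}_{i=0}^D$ be a $Q$-polynomial ordering of its primitive idempotents, let $x\in X$, and let $T^{\mathbb{R}}=T^{\mathbb{R}}(x)$ and $T^{\mathbb{C}}=T^{\mathbb{C}}(x)$ be the Terwilliger algebras of $\Gamma$ with respect to $x$ over $\mathbb{R}$ and over $\mathbb{C}$. Let $W_1,W_2$ be irreducible $T^{\mathbb{R}}$-modules. Then $W_1$ and $W_2$ are isomorphic as $T^{\mathbb{R}}$-modules if and only if their complexifications $W_1^{\mathbb{C}}$ and $W_2^{\mathbb{C}}$ are isomorphic as $T^{\mathbb{C}}$-modules.
   Context: $\Gamma$ is a finite, undirected, connected graph without loops or multiple edges, with vertex set $X$, path-length distance $\partial$ and diameter $D=\max\{\partial(y,z)\mid y,z\in X\}$. It is distance-regular: for all $0\le h,i,j\le D$ and all $y,z\in X$ with $\partial(y,z)=h$, the number $p^h_{i,j}=|\{w\in X\mid \partial(y,w)=i,\ \partial(z,w)=j\}|$ depends only on $h,i,j$. All matrices have rows and columns indexed by $X$. The adjacency matrix $A$ has $D+1$ distinct real eigenvalues $\theta_0,\dots,\theta_D$, with $\theta_0$ equal to the valency; the primitive idempotent $E_i$ is the matrix of the orthogonal projection onto the $\theta_i$-eigenspace of $A$. With $\circ$ the entrywise product, the Krein parameters $q^h_{i,j}$ are defined by $E_i\circ E_j=|X|^{-1}\sum_{h=0}^D q^h_{i,j}E_h$. The ordering $\{E_i\}_{i=0}^D$ is $Q$-polynomial if for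 all $0\le h,i,j\le D$: $q^h_{i,j}=0$ whenever one of $h,i,j$ is greater than the sum of the other two, and $q^h_{i,j}\ne0$ whenever one of $h,i,j$ equals the sum of the other two. For $0\le i\le D$, $E_i^*=E_i^*(x)$ is the diagonal matrix with $(y,y)$-entry $1$ if $\partial(x,y)=i$ and $0$ otherwise. For $\mathbb{F}\in\{\mathbb{R},\mathbb{C}\}$, the Terwilliger algebra $T^{\mathbb{F}}$ is the $\mathbb{F}$-subalgebra of the matrix algebra $\mathrm{Mat}_X(\mathbb{F})$ generated by $A$ and $E_0^*,\dots,E_D^*$. A $T^{\mathbb{F}}$-module is a subspace $W$ of $\mathbb{F}^X$ with $T^{\mathbb{F}}W\subseteq W$; it is irreducible if $W\ne0$ and it contains no $T^{\mathbb{F}}$-module other than $0$ and $W$. Two $T^{\mathbb{F}}$-modules $W,W'$ are isomorphic if there is a bijective $\mathbb{F}$-linear map $\sigma:W\to W'$ with $\sigma(Bw)=B\sigma(w)$ for all $B\in T^{\mathbb{F}}$, $w\in W$. One has $T^{\mathbb{C}}=T^{\mathbb{R}}+\boldsymbol{i}T^{\mathbb{R}}=T^{\mathbb{R}}\otimes_{\mathbb{R}}\mathbb{C}$, where $\boldsymbol{i}=\sqrt{-1}$. The complexification of a $T^{\mathbb{R}}$-module $W$ is the $T^{\mathbb{C}}$-module $W^{\mathbb{C}}=W\otimes_{\mathbb{R}}\mathbb{C}=W+\boldsymbol{i}W\subseteq\mathbb{C}^X$ (sum direct over $\mathbb{R}$). *)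

(* Defs.v *)
From HB Require Import structures.
From mathcomp Require Import all_boot all_order all_algebra.
From mathcomp Require Import complex reals.

Set Implicit Arguments.
Unset Strict Implicit.
Unset Printing Implicit Defensive.

Import GRing.Theory.
Local Open Scope ring_scope.

(** * Graphs *)

Section Graph.
Variables (X : finType) (e : rel X).

Record connected_simple_graph : Prop := ConnectedSimpleGraph {
  graph_sym : symmetric e;
  graph_irr : irreflexive e;
  graph_connected : forall y z : X, connect e y z }.

Definition walk_of_length (y z : X) (k : nat) : bool :=
  [exists p : k.-tuple X, path e y p && (last y p == z)].

(* The least k < #|X| for which there is a walk of length k from y to z; the
   bound loses nothing when z can be reached from y (see [gdist_walk]), and
   the value is the junk #|X| otherwise. *)
Definition gdist (y z : X) : nat :=
  find (walk_of_length y z) (iota 0 #|X|).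

Definition diameter : nat := (\max_(y : X) \max_(z : X) gdist y z)%N.

Definition distance_regular : Prop :=
  connected_simple_graph /\
  exists p : nat -> nat -> nat -> nat,
    forall h i j : nat,
      (h <= diameter)%N -> (i <= diameter)%N -> (j <= diameter)%N ->
    forall y z : X, gdist y z = h ->
      #|[set w | (gdist y w == i) && (gdist z w == j)]| = p h i j.

Lemma gdist_walk (y z : X) : connect e y z -> walk_of_length y z (gdist y z).
Proof.
case/connectP=> p ep ->; case: (shortenP ep) => q eq uq _ {p ep}.
have sq : (size q < #|X|)%N by rewrite -[X in (X <= _)%N](card_uniqP uq) max_card.
have hw : has (walk_of_length y (last y q)) (iota 0 #|X|).
  apply/hasP; exists (size q); first by rewrite mem_iota.
  by apply/existsP; exists (in_tuple q); rewrite eq eqxx.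
have := nth_find 0%N hw; rewrite nth_iota ?add0n //.
by rewrite has_find size_iota in hw.
Qed.

Lemma gdist_min (y z : X) (k : nat) :
  walk_of_length y z k -> (gdist y z <= k)%N.
Proof.
move=> wk; case: (ltnP k (gdist y z)) => // lt_k.
have sz : (k < #|X|)%N.
  apply: (leq_trans lt_k); rewrite -[leqRHS](size_iota 0 #|X|).
  exact: find_size.
by have := before_find 0%N lt_k; rewrite nth_iota // add0n wk.
Qed.

End Graph.

(** * Matrices indexed by the vertices *)

(* Rows and columns are indexed by the vertex set X through the enumeration
   [enum_val : 'I_#|X| -> X]. *)
Definition adjacency_mx (F : fieldType) (X : finType) (e : rel X) :
    'M[F]_#|X| :=
  \matrix_(i, j) (e (enum_val i) (enum_val j))%:R.

Definition dual_idempotent (F : fieldType) (X : finType) (e : rel X) (x : X)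
    (i : nat) : 'M[F]_#|X| :=
  diag_mx (\row_j (gdist e x (enum_val j) == i)%:R).

Definition is_orthogonal_projection (R : realType) (n : nat)
    (U : 'cV[R]_n -> Prop) (P : 'M[R]_n) : Prop :=
  forall v : 'cV[R]_n,
    U (P *m v) /\ forall u : 'cV[R]_n, U u -> u^T *m (v - P *m v) = 0.

(* [E] lists the primitive idempotents in an order for which the eigenvalue
   attached to [E ord0] is the valency. *)
Record primitive_idempotents (R : realType) (X : finType) (e : rel X)
    (theta : 'I_(diameter e).+1 -> R)
    (E : 'I_(diameter e).+1 -> 'M[R]_#|X|) : Prop := PrimitiveIdempotents {
  theta_inj : injective theta;
  theta_eigenvalue : forall a : R,
    eigenvalue (adjacency_mx R e) a <-> exists i, theta i = a;
  theta0_valency : forall y : X, theta ord0 = #|[set z | e y z]|%:R;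
  idempotent_projection : forall i,
    is_orthogonal_projection
      (fun v : 'cV[R]_#|X| => adjacency_mx R e *m v = theta i *: v) (E i) }.

Definition krein_parameters (R : realType) (X : finType) (d : nat)
    (E : 'I_d.+1 -> 'M[R]_#|X|) (q : 'I_d.+1 -> 'I_d.+1 -> 'I_d.+1 -> R) :
    Prop :=
  forall i j, map2_mx *%R (E i) (E j) =
    (#|X|%:R)^-1 *: \sum_(h < d.+1) q h i j *: E h.

(* For the primitive idempotents of a distance-regular graph the Krein
   parameters exist and are unique, the E_h being a basis of an algebra closed
   under entrywise product; hence the existential quantifier. *)
Definition q_polynomial (R : realType) (X : finType) (d : nat)
    (E : 'I_d.+1 -> 'M[R]_#|X|) : Prop :=
  exists q, krein_parameters E q /\
    forall h i j : 'I_d.+1,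
      ([|| i + j < h, h + j < i | h + i < j]%N -> q h i j = 0) /\
      ([|| h == i + j :> nat, i == h + j :> nat | j == h + i :> nat]%N ->
         q h i j != 0).

(** * Terwilliger algebra and its modules *)

Inductive generated_subalgebra (F : fieldType) (n : nat)
    (S : 'M[F]_n -> Prop) : 'M[F]_n -> Prop :=
| gen_base B : S B -> generated_subalgebra S B
| gen_one : generated_subalgebra S 1%:M
| gen_scale a B : generated_subalgebra S B -> generated_subalgebra S (a *: B)
| gen_add B C : generated_subalgebra S B -> generated_subalgebra S C ->
    generated_subalgebra S (B + C)
| gen_mul B C : generated_subalgebra S B -> generated_subalgebra S C ->
    generated_subalgebra S (B *m C).

Section Terwilliger.
Variables (F : fieldType) (X : finType) (e : rel X) (x : X).

Definition terwilliger : 'M[F]_#|X| -> Prop :=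
  generated_subalgebra (fun B =>
    B = adjacency_mx F e \/
    exists i : 'I_(diameter e).+1, B = dual_idempotent F e x i).

Definition T_module (W : {vspace 'cV[F]_#|X|}) : Prop :=
  forall B, terwilliger B -> forall w, w \in W -> B *m w \in W.

Definition T_irreducible (W : {vspace 'cV[F]_#|X|}) : Prop :=
  [/\ T_module W, W <> 0%VS
    & forall U : {vspace 'cV[F]_#|X|},
        T_module U -> (U <= W)%VS -> U = 0%VS \/ U = W].

(* [subvs_of W] is W as a vector space in its own right, [vsval] its inclusion
   in F^X; when W1 is a module, [vsproj W1] just views B w as an element of
   W1. *)
Definition T_isomorphic (W1 W2 : {vspace 'cV[F]_#|X|}) : Prop :=
  exists sigma : {linear subvs_of W1 -> subvs_of W2},
    bijective sigma /\
    forall B, terwilliger B -> forall w : subvs_of W1,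
      vsval (sigma (vsproj W1 (B *m vsval w))) = B *m vsval (sigma w).

End Terwilliger.

(** * Complexification *)

Section Complexification.
Variables (R : realType) (n : nat).

Definition complexification (W : {vspace 'cV[R]_n}) : {vspace 'cV[R[i]]_n} :=
  <<[seq map_mx (real_complex R) w | w <- vbasis W]>>%VS.

(* As a subset of C^n, the complexification is W + i W. *)
Lemma mem_complexification (W : {vspace 'cV[R]_n}) (v : 'cV[R[i]]_n) :
  v \in complexification W <->
  exists w w' : 'cV[R]_n, [/\ w \in W, w' \in W
    & v = map_mx (real_complex R) w + 'i%C *: map_mx (real_complex R) w'].
Proof.
pose f := map_mx (real_complex R) : 'cV[R]_n -> 'cV[R[i]]_n.
have sub w : w \in W -> f w \in complexification W.
  move=> wW; rewrite (coord_vbasis wW) /f raddf_sum memv_suml // => i _ /=.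
  rewrite map_mxZ memvZ // memv_span // map_f //.
  by rewrite mem_nth // size_tuple.
split; last first.
  by case=> w [w' [wW w'W ->]]; rewrite memvD ?memvZ //; apply: sub.
rewrite /complexification => vW.
have -> : v = \sum_(i < size [seq f w | w <- vbasis W])
    coord (in_tuple [seq f w | w <- vbasis W]) i v *: [seq f w | w <- vbasis W]`_i.
  exact: (@coord_span _ _ _ (in_tuple _)).
elim/big_ind: _ => [|v1 v2 [a [a' [aW a'W ->]]] [b [b' [bW b'W ->]]]|i _].
- by exists 0, 0; rewrite !mem0v map_mx0 scaler0 addr0.
- exists (a + b), (a' + b'); rewrite !memvD //; split=> //.
  by rewrite !map_mxD scalerDr addrACA.
set c := coord _ _ _; have ltis : (i < size (vbasis W))%N.
  by case: i @c => i /=; rewrite size_map.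
set w := (vbasis W)`_i; have wW : w \in W by rewrite vbasis_mem // mem_nth.
exists (complex.Re c *: w), (complex.Im c *: w); split; rewrite ?memvZ //.
rewrite (nth_map 0) // -/w /f !map_mxZ scalerA -scalerDl.
by congr (_ *: _); rewrite [LHS]complexE.
Qed.

End Complexification.

(* Main.v *)
(** Write a complex intertwiner W1^C -> W2^C as P + iQ with P, Q real.
    Comparing real and imaginary parts on W1, both P and Q are intertwiners
    W1 -> W2, and they do not both vanish on W1; by Schur's lemma a nonzero one
    is an isomorphism.  Conversely a real isomorphism stays one after extension
    of scalars, since T^C = T^R + i T^R. *)

Require Import Defs.
From HB Require Import structures.
From mathcomp Require Import all_boot all_order all_algebra.
From mathcomp Require Import complex reals.

Set Implicit Arguments.
Unset Strict Implicit.
Unset Printing Implicit Defensive.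

Import GRing.Theory.

(** * Intertwiners given by ambient matrices, and Schur's lemma *)

Section Intertwiners.
Local Open Scope ring_scope.
Variables (F : fieldType) (X : finType) (e : rel X) (x : X).
Local Notation n := #|X|.
Implicit Types (W : {vspace 'cV[F]_n}) (M N : 'M[F]_n).

(** Commutation is asked on [W] only: what [M] does off [W] is irrelevant, so any linear map defined
    on [W] can be represented by extending it to the whole space. *)
Definition intertwines W M : Prop :=
  forall B, terwilliger e x B ->
  forall w, w \in W -> M *m (B *m w) = B *m (M *m w).

Definition mxlfun M : 'End('cV[F]_n) := linfun (mulmx M).

Lemma mxlfunE M w : mxlfun M w = M *m w.
Proof. by rewrite lfunE. Qed.

Lemma linear_mx (f : 'End('cV[F]_n)) : exists M, forall w, M *m w = f w.
Proof.
exists (\matrix_(i, j) f (delta_mx j 0) i 0) => w.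
rewrite [in RHS](matrix_sum_delta w) linear_sum; apply/colP => i.
rewrite !mxE summxE; apply: eq_bigr => j _.
by rewrite big_ord1 linearZ /= !mxE mulrC.
Qed.

(** Precomposing with [vsproj] extends an isomorphism and its inverse to the ambient space. As
    matrices they can then be moved to the complex field or split into real and imaginary parts
    entrywise. *)
Lemma T_isomorphicP W1 W2 : T_module e x W1 ->
  T_isomorphic e x W1 W2 <->
  exists M N, [/\ intertwines W1 M,
    forall w, w \in W1 -> M *m w \in W2 /\ N *m (M *m w) = w
    & forall w, w \in W2 -> N *m w \in W1 /\ M *m (N *m w) = w].
Proof.
move=> W1T; split=> [[sigma [[tau sK tK] sigmaT]]|[M [N [MT NM MN]]]].
  (* [bijective] gives the inverse as a bare function; it is linear because [sigma] is linear and
     injective. *)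
  have tauL : linear tau.
    by move=> a u v; apply: (can_inj sK); rewrite linearP !tK.
  pose tau' := linfun (HB.pack_for {linear subvs_of W2 -> subvs_of W1} tau
    (GRing.isLinear.Build _ _ _ _ tau tauL)).
  have [M ME] := linear_mx (linfun (vsval \o sigma \o vsproj W1)).
  have [N NE] := linear_mx (linfun (vsval \o tau' \o vsproj W2)).
  exists M, N; split=> [B BT w wW|w wW|w wW].
  - rewrite !ME !lfunE /=.
    by rewrite -[in LHS](vsprojK wW) sigmaT.
  - by rewrite NE ME !lfunE /= subvsP vsvalK lfunE /= sK vsprojK.
  - by rewrite ME NE !lfunE /= subvsP vsvalK lfunE /= tK vsprojK.
pose sigma := linfun (vsproj W2 \o mxlfun M \o vsval : subvs_of W1 -> subvs_of W2).
have sE w : vsval (sigma w) = M *m vsval w.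
  by rewrite lfunE /= mxlfunE vsprojK // (NM _ (subvsP w)).1.
exists sigma; split.
  exists (fun w => vsproj W1 (N *m vsval w)) => w; apply: val_inj => /=.
    by rewrite sE (NM _ (subvsP w)).2 vsprojK ?subvsP.
  by have [NW MNw] := MN _ (subvsP w); rewrite sE vsprojK.
move=> B BT w; rewrite !sE vsprojK; first by rewrite MT ?subvsP.
by rewrite W1T ?subvsP.
Qed.

(** The kernel of [M] in [W1] and the image of [W1] are submodules; the vector not killed by [M]
    forces the first to be 0 and the second to be [W2]. This half of Schur's lemma holds over any
    field, hence over the reals. *)
Lemma schur W1 W2 M : T_irreducible e x W1 -> T_irreducible e x W2 ->
  intertwines W1 M -> (forall w, w \in W1 -> M *m w \in W2) ->
  (exists2 w, w \in W1 & M *m w != 0) -> T_isomorphic e x W1 W2.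
Proof.
move=> [W1T _ W1min] [W2T _ W2min] MT MW [w0 w0W Mw0].
have kerT : T_module e x (W1 :&: lker (mxlfun M)).
  move=> B BT w; rewrite !memv_cap !memv_ker !mxlfunE => /andP[wW /eqP Mw].
  by rewrite W1T // MT // Mw mulmx0 eqxx.
have ker0 : (W1 :&: lker (mxlfun M) = 0)%VS.
  case: (W1min _ kerT (capvSl _ _)) => // kerW.
  by move: w0W Mw0; rewrite -kerW memv_cap memv_ker mxlfunE => /andP[_ ->].
have imT : T_module e x (mxlfun M @: W1)%VS.
  move=> B BT _ /memv_imgP[w wW ->]; rewrite mxlfunE -MT // -mxlfunE.
  by rewrite memv_img // W1T.
have imW : (mxlfun M @: W1 = W2)%VS.
  have imS : (mxlfun M @: W1 <= W2)%VS.
    by apply/subvP=> _ /memv_imgP[w wW ->]; rewrite mxlfunE MW.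
  case: (W2min _ imT imS) => // im0.
  have := memv_img (mxlfun M) w0W.
  by rewrite im0 memv0 mxlfunE (negPf Mw0).
(* [M] may have a kernel outside [W1]; restricting its domain to [subvs_of W1] makes it injective,
   so that [f^-1] is a left inverse. *)
pose f := (mxlfun M \o linfun (vsval : subvs_of W1 -> _))%VF.
have fE w : f w = M *m vsval w by rewrite lfunE /= mxlfunE lfunE.
have f_inj : lker f == 0%VS.
  rewrite -subv0; apply/subvP=> w; rewrite memv_ker fE => Mw.
  have: vsval w \in (W1 :&: lker (mxlfun M))%VS.
    by rewrite memv_cap subvsP memv_ker mxlfunE.
  by rewrite ker0 !memv0 => /eqP w_0; apply/eqP/val_inj.
have [N NE] := linear_mx (linfun (vsval : subvs_of W1 -> _) \o f^-1)%VF.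
have NM w : w \in W1 -> N *m (M *m w) = w.
  move=> wW; rewrite NE !lfunE /= -[in LHS](vsprojK wW) -fE.
  by rewrite lker0_lfunK // lfunE /= vsprojK.
apply/T_isomorphicP => //; exists M, N; split=> // w; first by split; auto.
by rewrite -imW => /memv_imgP[v vW ->]; rewrite mxlfunE NM.
Qed.

End Intertwiners.

(** * Real and imaginary parts of complex matrices *)

Section Complexification.
Local Open Scope ring_scope.
Variables (R : realType) (m n : nat).
Local Notation rc := (map_mx (real_complex R)).

Lemma mx_re_im (M : 'M[R[i]]_(m, n)) :
  M = rc (map_mx (@complex.Re R) M) + 'i%C *: rc (map_mx (@complex.Im R) M).
Proof. by apply/matrixP=> i j; rewrite !mxE [LHS]complexE. Qed.

Lemma mx_re_im_inj (a b c d : 'M[R]_(m, n)) :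
  rc a + 'i%C *: rc b = rc c + 'i%C *: rc d -> a = c /\ b = d.
Proof.
move=> eq_ab; split; apply/matrixP=> i j;
  by move/matrixP/(_ i j): eq_ab; rewrite !mxE; simpc => -[].
Qed.

End Complexification.

(** * Passing between the real and the complex Terwilliger algebra *)

Section TerwilligerComplex.
Local Open Scope ring_scope.
Variables (R : realType) (X : finType) (e : rel X) (x : X).
Local Notation rc := (map_mx (real_complex R)).

Lemma adjacency_complex : rc (adjacency_mx R e) = adjacency_mx R[i] e.
Proof. by apply/matrixP=> i j; rewrite !mxE rmorph_nat. Qed.

Lemma dual_idempotent_complex i :
  rc (dual_idempotent R e x i) = dual_idempotent R[i] e x i.
Proof. by apply/matrixP=> j k; rewrite !mxE rmorphMn rmorph_nat. Qed.

Lemma terwilliger_complex B : terwilliger e x B -> terwilliger e x (rc B).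
Proof.
elim=> {B} [B [->|[i ->]]||a B _ IH|B C _ IHB _ IHC|B C _ IHB _ IHC].
- by rewrite adjacency_complex; apply: gen_base; left.
- by rewrite dual_idempotent_complex; apply: gen_base; right; exists i.
- by rewrite map_mx1; apply: gen_one.
- by rewrite map_mxZ; apply: gen_scale.
- by rewrite map_mxD; apply: gen_add.
- by rewrite map_mxM; apply: gen_mul.
Qed.

(** The generators have entries 0 and 1, hence are real, and sums of the form
    [rc B1 + 'i%C *: rc B2] are closed under complex scaling, addition and product. *)
Lemma terwilliger_re_im (B : 'M[R[i]]_#|X|) : terwilliger e x B ->
  exists B1 B2, [/\ terwilliger e x B1, terwilliger e x B2
    & B = rc B1 + 'i%C *: rc B2].
Proof.
(* Zero serves as the imaginary part of the real elements; no constructor gives it directly. *)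
have gen0 : terwilliger e x (0 : 'M[R]_#|X|).
  by rewrite -(scale0r 1%:M); apply/gen_scale/gen_one.
have real B1 : terwilliger e x B1 -> exists B1' B2,
    [/\ terwilliger e x B1', terwilliger e x B2
    & rc B1 = rc B1' + 'i%C *: rc B2].
  by exists B1, 0; rewrite map_mx0 scaler0 addr0.
have i2 : 'i%C * 'i%C = -1 :> R[i] by rewrite -expr2 sqr_i.
have genN (C : 'M[R]_#|X|) : terwilliger e x C -> terwilliger e x (- C).
  by move=> CT; rewrite -scaleN1r; apply: gen_scale.
elim=> {B} [B [->|[i ->]]||a B _ [B1 [B2 [T1 T2 ->]]]|
    B C _ [B1 [B2 [T1 T2 ->]]] _ [C1 [C2 [S1 S2 ->]]]|
    B C _ [B1 [B2 [T1 T2 ->]]] _ [C1 [C2 [S1 S2 ->]]]].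
- by rewrite -adjacency_complex; apply/real/gen_base; left.
- by rewrite -dual_idempotent_complex; apply/real/gen_base; right; exists i.
- by rewrite -(map_mx1 (real_complex R)); apply/real/gen_one.
- exists (complex.Re a *: B1 - complex.Im a *: B2),
    (complex.Re a *: B2 + complex.Im a *: B1).
  split; first by apply: gen_add; [|apply: genN]; apply: gen_scale.
    by apply: gen_add; apply: gen_scale.
  apply/matrixP=> j k; rewrite !mxE.
  by case: a => a1 a2; simpc.
- exists (B1 + C1), (B2 + C2); split; [exact: gen_add..|].
  by rewrite !map_mxD scalerDr addrACA.
exists (B1 *m C1 - B2 *m C2), (B1 *m C2 + B2 *m C1); split.
- by apply: gen_add; [|apply: genN]; apply: gen_mul.
- by apply: gen_add; apply: gen_mul.
rewrite map_mxB map_mxD !map_mxM mulmxDl !mulmxDr -!scalemxAl -!scalemxAr.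
rewrite scalerA i2 scaleN1r scalerDr -!addrA; congr (_ + _).
by rewrite addrA addrC.
Qed.

Lemma T_module_complexification (W : {vspace 'cV[R]_#|X|}) :
  T_module e x W -> T_module e x (complexification W).
Proof.
move=> WT B /terwilliger_re_im[B1 [B2 [T1 T2 ->]]] w.
have WB C v : terwilliger e x C -> v \in W ->
    rc C *m rc v \in complexification W.
  move=> CT vW; apply/mem_complexification; exists (C *m v), 0.
  by rewrite WT ?mem0v // map_mxM map_mx0 scaler0 addr0.
case/mem_complexification=> w1 [w2 [w1W w2W ->]].
by rewrite mulmxDl !mulmxDr -!scalemxAl -!scalemxAr;
  rewrite !memvD ?memvZ ?WB.
Qed.

Lemma T_isomorphic_complexification (W1 W2 : {vspace 'cV[R]_#|X|}) :
  T_irreducible e x W1 -> T_irreducible e x W2 ->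
  T_isomorphic e x W1 W2 <->
  T_isomorphic e x (complexification W1) (complexification W2).
Proof.
move=> W1_irr W2_irr; have [W1T W1n0 _] := W1_irr.
have W1CT := T_module_complexification W1T.
split.
  move/(T_isomorphicP _ W1T) => [M [N [MT NM MN]]].
  (* The same matrices, read over the complex field; each condition reduces to real vectors and real
     algebra elements by bilinearity. *)
  apply/(T_isomorphicP _ W1CT); exists (rc M), (rc N); split.
  - move=> _ /terwilliger_re_im[B1 [B2 [T1 T2 ->]]] w.
    case/mem_complexification=> w1 [w2 [w1W w2W ->]].
    have com B v : terwilliger e x B -> v \in W1 ->
        rc M *m (rc B *m rc v) = rc B *m (rc M *m rc v).
      by move=> BT vW; rewrite -!map_mxM MT.
    by rewrite !(mulmxDl, mulmxDr) -!(scalemxAl, scalemxAr) !com.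
  - move=> w /mem_complexification[w1 [w2 [w1W w2W ->]]].
    have [[M1 N1] [M2 N2]] := (NM _ w1W, NM _ w2W).
    rewrite !mulmxDr -!scalemxAr -!map_mxM N1 N2; split=> //.
    by apply/mem_complexification; exists (M *m w1), (M *m w2).
  - move=> w /mem_complexification[w1 [w2 [w1W w2W ->]]].
    have [[M1 N1] [M2 N2]] := (MN _ w1W, MN _ w2W).
    rewrite !mulmxDr -!scalemxAr -!map_mxM N1 N2; split=> //.
    by apply/mem_complexification; exists (N *m w1), (N *m w2).
(* Only the left inverse is kept: it yields a nonzero real intertwiner, and [schur] supplies
   surjectivity. *)
move/(T_isomorphicP _ W1CT) => [M [N [MT NM _]]].
pose P := map_mx (@complex.Re R) M; pose Q := map_mx (@complex.Im R) M.
have ME w : M *m rc w = rc (P *m w) + 'i%C *: rc (Q *m w).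
  by rewrite {1}(mx_re_im M) mulmxDl -scalemxAl -!map_mxM.
have W1C w : w \in W1 -> rc w \in complexification W1.
  move=> wW; apply/mem_complexification; exists w, 0.
  by rewrite mem0v map_mx0 scaler0 addr0.
have PQW w : w \in W1 -> P *m w \in W2 /\ Q *m w \in W2.
  move/W1C/NM => [+ _]; rewrite ME => /mem_complexification[u [v [uW vW]]].
  by case/mx_re_im_inj=> -> ->.
(* For real [B] and [w], both sides of the relation for [M] split into real and imaginary parts,
   which must agree separately. *)
have PQT B w : terwilliger e x B -> w \in W1 ->
    P *m (B *m w) = B *m (P *m w) /\ Q *m (B *m w) = B *m (Q *m w).
  move=> BT /W1C wW; have := MT _ (terwilliger_complex BT) _ wW.
  rewrite -map_mxM ME ME mulmxDr -scalemxAr -!map_mxM.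
  exact: mx_re_im_inj.
(* One nonzero test vector suffices, since [schur] asks for a single vector that is not killed. *)
have W1nz : vpick W1 != 0 by rewrite vpick0; apply/eqP.
have [P0|Pn0] := eqVneq (P *m vpick W1) 0; last first.
  apply: (schur W1_irr W2_irr (M := P)).
  - by move=> B BT w wW; case: (PQT B w).
  - by move=> w /PQW[].
  - by exists (vpick W1); rewrite ?memv_pick.
apply: (schur W1_irr W2_irr (M := Q)).
- by move=> B BT w wW; case: (PQT B w).
- by move=> w /PQW[].
(* If [P] and [Q] both killed the test vector, so would [M], and applying [N] would make the vector
   0. *)
exists (vpick W1); rewrite ?memv_pick //; apply: contraNneq W1nz => Q0.
have [_] := NM _ (W1C _ (memv_pick W1)).
rewrite ME P0 Q0 map_mx0 scaler0 addr0 mulmx0 => /esym/eqP.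
by rewrite map_mx_eq0.
Qed.

End TerwilligerComplex.

Theorem theorem1p4 (R : realType) (X : finType) (e : rel X)
    (e_drg : distance_regular e) (D_ge3 : 3 <= diameter e)
    (theta : 'I_(diameter e).+1 -> R)
    (E : 'I_(diameter e).+1 -> 'M[R]_#|X|)
    (E_idem : primitive_idempotents theta E) (E_Qpoly : q_polynomial E)
    (x : X) (W1 W2 : {vspace 'cV[R]_#|X|})
    (W1_irr : T_irreducible e x W1) (W2_irr : T_irreducible e x W2) :
  T_isomorphic e x W1 W2 <->
  T_isomorphic e x (complexification W1) (complexification W2).
Proof. exact: T_isomorphic_complexification. Qed.
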